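(* Let $(\mathbf{x}_i^T,y_i)$, $i=1,\dots,n$, be a sample with $\mathbf{x}_i\in\mathbb{R}^p$, $y_i\in\mathbb{R}$. Let $\rho_0,\rho_1$ be bounded $\rho$-functions with $\rho_1\le\rho_0$, let $0<b<1$ and $q>0$, and let $\hat{\boldsymbol\beta}_1$ be a consistent initial estimate of the regression parameter $\boldsymbol\beta_0$. Let $\hat{\boldsymbol\beta}_B$ be the $\ell_q$-penalized MM-Bridge estimator $$\hat{\boldsymbol\beta}_B=\arg\min_{\boldsymbol\beta\in\mathbb{R}^p}\ \sum_{i=1}^n\rho_1\!\left(\frac{y_i-\mathbf{x}_i^T\boldsymbol\beta}{s_n(\mathbf{r}(\hat{\boldsymbol\beta}_1))}\right)+\lambda_n\sum_{j=1}^p|\beta_j|^q ,$$ where, if the model contains an intercept, the intercept is not penalized. If $\lambda_n>0$ is fixed, then the finite-sample replacement breakdown point of $\hat{\boldsymbol\beta}_B$ satisfies $FBP(\hat{\boldsymbol\beta}_B)\ge 1-\frac1n$.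
   Context: Model: the $(\mathbf{x}_i^T,y_i)$ are i.i.d. with $y_i=\mathbf{x}_i^T\boldsymbol\beta_0+u_i$, $\boldsymbol\beta_0\in\mathbb{R}^p$, and $u_i$ independent of $\mathbf{x}_i$; consistency of $\hat{\boldsymbol\beta}_1$ refers to this model. ''Fixed'' means that $\lambda_n$ is not selected by a data-driven procedure. A bounded $\rho$-function is a function $\rho:\mathbb{R}\to[0,1]$ such that $\rho(u)$ is a nondecreasing function of $|u|$, $\rho(0)=0$, $\lim_{u\to\infty}\rho(u)=1$, and $\rho$ is strictly increasing on $\{u>0:\rho(u)<1\}$. Residuals: $\mathbf{r}(\boldsymbol\beta)=(r_1(\boldsymbol\beta),\dots,r_n(\boldsymbol\beta))$ with $r_i(\boldsymbol\beta)=y_i-\mathbf{x}_i^T\boldsymbol\beta$. M-estimate of scale: for $\mathbf{u}=(u_1,\dots,u_n)$, $s_n(\mathbf{u})=\inf\{s>0:\frac1n\sum_{i=1}^n\rho_0(u_i/s)\le b\}$. Finite-sample replacement breakdown point: for a regression estimator $\hat{\boldsymbol\beta}$ and a data set $\mathbf{Z}=\{(\mathbf{x}_1^T,y_1),\dots,(\mathbf{x}_n^T,y_n)\}$, let $\mathcal{Z}_m$ be the set of all data sets (of size $n$) with at least $n-m$ elements in common with $\mathbf{Z}$. Then $FBP(\hat{\boldsymbol\beta})=m^*/n$, where $m^*=\max\{m\ge0:\hat{\boldsymbol\beta}(\mathbf{Z}_m)\text{ is bounded for all }\mathbf{Z}_m\in\mathcal{Z}_m\}$, i.e. the largest $m$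 such that $\{\hat{\boldsymbol\beta}(\mathbf{Z}_m):\mathbf{Z}_m\in\mathcal{Z}_m\}$ is bounded. When $\hat{\boldsymbol\beta}_B$ is evaluated at a contaminated data set, $\hat{\boldsymbol\beta}_1$ and the scale are computed from that same data set.
   Formalization: If the model contains an unpenalized intercept, the breakdown point is taken for the penalized coefficients only, because the intercept estimate itself can be made unbounded by replacing n-1 observations; without an intercept the claim is for the whole vector. *)

(* Defs.v *)
From HB Require Import structures.
From mathcomp Require Import all_boot all_order all_algebra all_fingroup.
From mathcomp Require Import all_classical all_reals all_analysis.
Set Implicit Arguments.
Unset Strict Implicit.
Unset Printing Implicit Defensive.
Import Order.TTheory GRing.Theory Num.Theory.
Import numFieldNormedType.Exports.
Local Open Scope classical_set_scope.
Local Open Scope ring_scope.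

Record bounded_rho (R : realType) (rho : R -> R) : Prop := BoundedRho {
  bounded_rho_range : forall u, 0 <= rho u <= 1 ;
  (* monotone in |u|; in particular rho u depends on |u| only *)
  bounded_rho_mono : forall u v, `|u| <= `|v| -> rho u <= rho v ;
  bounded_rho0 : rho 0 = 0 ;
  bounded_rho_lim : rho u @[u --> +oo] --> (1 : R) ;
  bounded_rho_strict : forall u v,
    0 < u -> u < v -> rho u < 1 -> rho v < 1 -> rho u < rho v }.

(* rho extended to infinite arguments by its limit.  It is applied to the
   residual/scale ratio, computed in the extended reals: there
   r / 0 = +oo, 0, -oo according to the sign of r, and r / +oo = 0. *)
Definition rho_bar (R : realType) (rho : R -> R) (t : \bar R) : R :=
  if t is r%:E then rho r else 1.

(* An infimum in the extended reals: +oo when no s is admissible, which can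
   happen since rho0 need not be continuous at 0. *)
Definition m_scale (R : realType) (rho0 : R -> R) (b : R) (n : nat)
    (u : 'I_n -> R) : \bar R :=
  ereal_inf [set s%:E | s in [set s : R |
    0 < s /\ n%:R^-1 * (\sum_(i < n) rho0 (u i / s)) <= b]].

(* The pairs (x_i, y_i), without the constant regressor. *)
Definition dataset (R : realType) (n p : nat) := 'I_n -> 'rV[R]_p * R.

(* The model has an intercept iff icpt = true.  With the coercion of booleans
   to {0, 1}, a parameter theta : 'rV_(icpt + p) is the row of the intercept
   (if any) followed by the p penalized coefficients, rsubmx theta; for
   icpt = false it is just a vector of R^p. *)
Definition linear_predictor (R : realType) (icpt : bool) (p : nat)
    (theta : 'rV[R]_(icpt + p)) (x : 'rV[R]_p) : R :=
  (row_mx (const_mx 1 : 'rV[R]_icpt) x *m theta^T) 0 0.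

Definition residuals (R : realType) (icpt : bool) (n p : nat)
    (Z : dataset R n p) (theta : 'rV[R]_(icpt + p)) : 'I_n -> R :=
  fun i => (Z i).2 - linear_predictor theta (Z i).1.

Definition mm_bridge_objective (R : realType) (icpt : bool) (n p : nat)
    (rho0 rho1 : R -> R) (b q lambda : R)
    (beta1 : dataset R n p -> 'rV[R]_(icpt + p))
    (Z : dataset R n p) (theta : 'rV[R]_(icpt + p)) : R :=
  let s := m_scale rho0 b (residuals Z (beta1 Z)) in
  \sum_(i < n) rho_bar rho1 ((residuals Z theta i)%:E / s)%E
  + lambda * \sum_(j < p) `|rsubmx theta 0 j| `^ q.

Definition argmin (R : realType) (T : Type) (f : T -> R) : set T :=
  [set t | forall t', f t <= f t'].

(* Since minimizers need not be unique (or exist), the estimator is the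
   set-valued map sending a data set to the penalized coefficients of all
   minimizers; any rule selecting one minimizer takes its values in it. *)
Definition mm_bridge (R : realType) (icpt : bool) (n p : nat)
    (rho0 rho1 : R -> R) (b q lambda : R)
    (beta1 : dataset R n p -> 'rV[R]_(icpt + p))
    (Z : dataset R n p) : set 'rV[R]_p :=
  [set rsubmx theta | theta in
     argmin (mm_bridge_objective rho0 rho1 b q lambda beta1 Z)].

(* Common elements are counted with multiplicity and regardless of the order
   of the observations, hence the permutation s. *)
Definition contaminated (R : realType) (n p : nat) (Z : dataset R n p)
    (m : nat) : set (dataset R n p) :=
  [set Z' | exists s : 'S_n, (n - m <= #|[pred i | Z' (s i) == Z i]|)%N].

(* The number m of replaced observations ranges over 0, ..., n. *)
Definition FBP (R : realType) (n p : nat)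
    (T : dataset R n p -> set 'rV[R]_p) (Z : dataset R n p) : R :=
  (\max_(m < n.+1 |
      `[< bounded_set (\bigcup_(Z' in contaminated Z m) T Z') >]) m)%N%:R
  / n%:R.

Definition borel (T : topologicalType) : set (set T) :=
  <<s [set A : set T | open A] >>.

Definition random_element (d : measure_display) (Omega : measurableType d)
    (T : topologicalType) (X : Omega -> T) : Prop :=
  forall B, borel B -> measurable (X @^-1` B).

Definition independent (R : realType) (d : measure_display)
    (Omega : measurableType d) (P : probability Omega R)
    (T U : topologicalType) (X : Omega -> T) (Y : Omega -> U) : Prop :=
  forall A B, borel A -> borel B ->
    P (X @^-1` A `&` Y @^-1` B) = (P (X @^-1` A) * P (Y @^-1` B))%E.

(* Taking some of the B i to be the whole space gives the product rule for
   every finite subfamily. *)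
Definition iid (R : realType) (d : measure_display)
    (Omega : measurableType d) (P : probability Omega R)
    (T : topologicalType) (X : nat -> Omega -> T) : Prop :=
  [/\ forall i, random_element (X i),
      forall i B, borel B -> P (X i @^-1` B) = P (X 0%N @^-1` B) &
      forall (N : nat) (B : nat -> set T), (forall i, borel (B i)) ->
        P (\bigcap_(i in `I_N) X i @^-1` B i)
        = (\prod_(i < N) P (X i @^-1` B i))%E].

Record linear_model (R : realType) (icpt : bool) (p : nat)
    (d : measure_display) (Omega : measurableType d)
    (P : probability Omega R) (x : nat -> Omega -> 'rV[R]_p)
    (y u : nat -> Omega -> R) (beta0 : 'rV[R]_(icpt + p)) : Prop :=
  LinearModel {
  model_iid : iid P (fun i w => (x i w, y i w)) ;
  model_eq : forall i w, y i w = linear_predictor beta0 (x i w) + u i w ;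
  model_indep : forall i, independent P (u i) (x i) }.

(* Convergence in probability of the estimator along the samples of the first
   n observations. *)
Definition consistent (R : realType) (icpt : bool) (p : nat)
    (d : measure_display) (Omega : measurableType d)
    (P : probability Omega R) (x : nat -> Omega -> 'rV[R]_p)
    (y : nat -> Omega -> R) (beta0 : 'rV[R]_(icpt + p))
    (beta : forall n, dataset R n p -> 'rV[R]_(icpt + p)) : Prop :=
  let betahat n w := beta n (fun i : 'I_n => (x i w, y i w)) in
  (forall n, random_element (betahat n)) /\
  (forall e : R, 0 < e ->
     P [set w | e <= `|betahat n w - beta0|] @[n --> \oo] --> 0%E).

(* Main.v *)
Require Import Defs.
From HB Require Import structures.
From mathcomp Require Import all_boot all_order all_algebra all_fingroup.
From mathcomp Require Import all_classical all_reals all_analysis.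
Set Implicit Arguments.
Unset Strict Implicit.
Unset Printing Implicit Defensive.
Import Order.TTheory GRing.Theory Num.Theory.
Import numFieldNormedType.Exports.
Local Open Scope classical_set_scope.
Local Open Scope ring_scope.

(** Every minimizer does at least as well as [0], whose objective is at most
    [n] whatever the data and the scale, because [rho1 <= 1].  Hence
    [lambda * \sum_j |beta_j|^q <= n] at every minimizer, a bound on [beta]
    that holds even when all [n] observations are replaced. *)

(** The value 1 at infinite arguments stays in the range of [rho], so each loss term is controlled
    even when the scale degenerates to 0 or +oo. *)
Lemma rho_bar_ge0 (R : realType) (rho : R -> R) (t : \bar R) :
  bounded_rho rho -> 0 <= rho_bar rho t.
Proof.
by case=> rho01 _ _ _ _; case: t => [r||] //=; have /andP[] := rho01 r.
Qed.

Lemma rho_bar_le1 (R : realType) (rho : R -> R) (t : \bar R) :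
  bounded_rho rho -> rho_bar rho t <= 1.
Proof.
by case=> rho01 _ _ _ _; case: t => [r||] //=; have /andP[] := rho01 r.
Qed.

Lemma ger0_powR_le (R : realType) (q c a : R) :
  0 < q -> 0 <= a -> a `^ q <= c -> a <= c `^ q^-1.
Proof.
move=> q_gt0 a_ge0 le_aq_c.
(* Once [a] is written as (a^q)^(1/q), monotonicity of t^(1/q) on t >= 0 concludes. *)
rewrite -[a]powRr1 // -(mulfV (lt0r_neq0 q_gt0)) powRrM.
apply: ge0_ler_powR => //; rewrite ?invr_ge0 ?nnegrE ?powR_ge0 ?(ltW q_gt0) //.
exact: le_trans (powR_ge0 _ _) le_aq_c.
Qed.

(** The norm is the maximum of 0 and the absolute entries; [0 <= M] covers [p = 0]. *)
Lemma rV_norm_le (R : realType) (p : nat) (v : 'rV[R]_p) (M : R) :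
  0 <= M -> (forall j, `|v 0 j| <= M) -> `|v| <= M.
Proof.
move=> M_ge0 le_vM; rewrite [`|v|]mx_normrE; apply: bigmax_le => // -[i j] _ /=.
by rewrite [i]ord1.
Qed.

Section Minimizers.
Variables (R : realType) (icpt : bool) (n p : nat) (rho0 rho1 : R -> R).
Variables (b q lambda : R) (beta1 : dataset R n p -> 'rV[R]_(icpt + p)).
Hypotheses (rho1P : bounded_rho rho1) (q_gt0 : 0 < q) (lambda_gt0 : 0 < lambda).

Lemma mm_bridge_objective0_le (Z : dataset R n p) :
  mm_bridge_objective rho0 rho1 b q lambda beta1 Z 0 <= n%:R.
Proof.
(* The penalty vanishes at 0 because [q] is nonzero; by convention 0^0 is 1. *)
rewrite /mm_bridge_objective [X in lambda * X]big1 => [|j _]; last first.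
  by rewrite !mxE normr0 powR0 ?gt_eqF.
rewrite mulr0 addr0 -[n in leRHS]card_ord -sumr_const.
by apply: ler_sum => i _; exact: rho_bar_le1.
Qed.

Lemma penalty_le_mm_bridge_objective (Z : dataset R n p) theta (j : 'I_p) :
  lambda * `|rsubmx theta 0 j| `^ q
  <= mm_bridge_objective rho0 rho1 b q lambda beta1 Z theta.
Proof.
rewrite /mm_bridge_objective (bigD1 j) //= mulrDr addrCA lerDl addr_ge0 //.
  by apply: sumr_ge0 => i _; exact: rho_bar_ge0.
by rewrite mulr_ge0 ?(ltW lambda_gt0) ?sumr_ge0 // => i _; exact: powR_ge0.
Qed.

(** The bound comes from solving [lambda] |beta_j|^q <= n for |beta_j|. It does not involve [Z],
    hence is uniform over all data sets. *)
Lemma mm_bridge_norm_le (Z : dataset R n p) beta :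
  mm_bridge rho0 rho1 b q lambda beta1 Z beta ->
  `|beta| <= (n%:R / lambda) `^ q^-1.
Proof.
case=> theta theta_min <-; apply: rV_norm_le => [|j]; first exact: powR_ge0.
apply: ger0_powR_le => //; rewrite ler_pdivlMr // mulrC.
apply: le_trans (penalty_le_mm_bridge_objective Z theta j) _.
exact: le_trans (theta_min 0) (mm_bridge_objective0_le Z).
Qed.

End Minimizers.

(** A bound over all data sets makes even [m = n] admissible, the largest index in the maximum. *)
Lemma FBP_eq1 (R : realType) (n p : nat) (T : dataset R n p -> set 'rV[R]_p)
    (Z : dataset R n p) :
  (0 < n)%N -> bounded_set (\bigcup_Z' T Z') -> FBP T Z = 1.
Proof.
move=> n_gt0 T_bounded; rewrite /FBP.
set k := (\max_(m < _ | _) _)%N.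
suff -> : k = n by rewrite divff // pnatr_eq0 -lt0n.
apply/eqP; rewrite eqn_leq; apply/andP; split.
  by apply/bigmax_leqP => m _; rewrite -ltnS.
apply: (leq_bigmax_cond (ord_max : 'I_n.+1)); apply/asboolP.
move: T_bounded; rewrite /bounded_near /=; apply: filterS => M T_le beta [Z' _ TZ'].
by apply: T_le; exists Z'.
Qed.

Theorem theorem1 (R : realType) (icpt : bool) (n p : nat) (n_gt0 : (0 < n)%N)
  (rho0 rho1 : R -> R) (rho0P : bounded_rho rho0) (rho1P : bounded_rho rho1)
  (rho_le : forall t, rho1 t <= rho0 t)
  (b q : R) (b01 : 0 < b < 1) (q_gt0 : 0 < q)
  (d : measure_display) (Omega : measurableType d) (P : probability Omega R)
  (x : nat -> Omega -> 'rV[R]_p) (y u : nat -> Omega -> R)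
  (beta0 : 'rV[R]_(icpt + p)) (modelP : linear_model P x y u beta0)
  (beta1 : forall k : nat, dataset R k p -> 'rV[R]_(icpt + p))
  (beta1_consistent : consistent P x y beta0 beta1)
  (lambda : nat -> R) (lambda_gt0 : 0 < lambda n)
  (Z : dataset R n p) :
  1 - n%:R^-1 <= FBP (mm_bridge rho0 rho1 b q (lambda n) (beta1 n)) Z.
Proof.
(* The breakdown point is exactly 1. Boundedness asks for a bound by every [M] near +oo, so every
   [M] above the uniform bound serves. *)
rewrite FBP_eq1 ?gerBl ?invr_ge0 // /bounded_near /=.
apply: filterS (nbhs_pinfty_ge (num_real ((n%:R / lambda n) `^ q^-1))).
move=> M le_M beta [Z' _ Z'beta]; apply: le_trans le_M.
exact: mm_bridge_norm_le Z'beta.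
Qed.
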